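(* Let $c\neq0$ and consider the equation $$-\partial_x\nabla_vE(u,u')+\nabla_uE(u,u')+DS(u)^T\,K*S(u)=c\,\Gamma(u)u'. \qquad(\ast)$$ Define $$\mathcal L(u):=-\Big(E(u,u')-\nabla_vE(u,u')\cdot u'+\tfrac12S(u)\cdot K*S(u)\Big)\Big|_{x=0}+\tfrac12\iint_Q\Big(S(u(x))\cdot K(x-y)DS(u(y))u'(y)-S(u(y))\cdot K(x-y)DS(u(x))u'(x)\Big)dx\,dy,$$ with $Q:=(-\infty,0)\times(0,\infty)$. Then $\mathcal L$ is monotone under the shift action $\phi_\tau u(x)=u(x+\tau)$ on solutions of $(\ast)$: for any $u\in C^R_b(\mathbb R,\mathbb R^d)$ solving $(\ast)$ and any $-\infty<a\le b<\infty$, $$\mathcal L(\phi_bu)-\mathcal L(\phi_au)=-c\int_a^b\Gamma(u)u'\cdot u'\,dx.$$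
   Context: $\mathcal M(\mathbb R^d)$ denotes real $d\times d$ matrices. The kernel $K:\mathbb R\to\mathcal M(\mathbb R^d)$ satisfies $K(r)=K(-r)$, $K(r)=K(r)^T$, $K\in L^1(\mathbb R,\mathcal M(\mathbb R^d))$, and $\int_{\mathbb R}(1+|r|)\|K(r)\|\,dr<\infty$. $S\in C^2(\mathbb R^d,\mathbb R^d)$, $E=E(u,v)\in C^2(\mathbb R^d\times\mathbb R^d,\mathbb R)$, and $K*S(u)(x)=\int_{\mathbb R}K(x-y)S(u(y))\,dy$. $\Gamma\in C^0_b(\mathbb R^d,\mathcal M(\mathbb R^d))$ (bounded continuous) takes its values in the cone of positive definite $d\times d$ matrices. Set $R=1$ if $\nabla_vE\equiv0$ and $R=2$ otherwise; solutions are taken of class $C^R$. $C^k_b(\mathbb R,\mathbb R^d)$ is the space of $C^k$ functions which are uniformly bounded together with their first $k$ derivatives. *)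

(* Defs.v *)
From HB Require Import structures.
From mathcomp Require Import all_boot all_order all_algebra.
From mathcomp Require Import all_classical all_reals all_analysis.
Set Implicit Arguments.
Unset Strict Implicit.
Unset Printing Implicit Defensive.
Import Order.TTheory GRing.Theory Num.Theory.
Import numFieldNormedType.Exports.
Local Open Scope ring_scope.
Local Open Scope classical_set_scope.

Definition dotv (R : realType) (d : nat) (v w : 'cV[R]_d) : R :=
  \sum_(i < d) v i 0 * w i 0.

(* No symmetry is required: only the quadratic form has to be positive. *)
Definition posdefmx (R : realType) (d : nat) (A : 'M[R]_d) : Prop :=
  forall v : 'cV[R]_d, v != 0 -> 0 < dotv (A *m v) v.

(* C^k in the Frechet sense; on finite-dimensional spaces, continuity of all
   directional derivatives amounts to continuity of the differential. *)
Fixpoint Ck (R : realType) (V W : normedModType R) (k : nat) (f : V -> W)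
    : Prop :=
  if k is k'.+1 then
    (forall x, differentiable f x) /\ (forall v, Ck k' (fun x => 'D_v f x))
  else continuous f.

Definition Ckb (R : realType) (d : nat) (k : nat) (u : R -> 'cV[R]_d) : Prop :=
  (forall j x, (j < k)%N -> derivable (derive1n j u) x 1) /\
  (forall j, (j <= k)%N ->
     continuous (derive1n j u) /\ bounded_fun (derive1n j u)).

(* The Jacobian matrix for column vectors: DS(u) *m w is the derivative of S
   at u along w. (The library's 'J acts on row vectors, hence is transposed.) *)
Definition DS (R : realType) (d : nat) (S : 'cV[R]_d -> 'cV[R]_d)
    (u : 'cV[R]_d) : 'M[R]_d :=
  \matrix_(i, j) ('D_(delta_mx j 0) S u) i 0.

Definition grad_u (R : realType) (d : nat) (E : 'cV[R]_d * 'cV[R]_d -> R)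
    (u v : 'cV[R]_d) : 'cV[R]_d :=
  \col_i 'D_(delta_mx i 0) (fun w => E (w, v)) u.

Definition grad_v (R : realType) (d : nat) (E : 'cV[R]_d * 'cV[R]_d -> R)
    (u v : 'cV[R]_d) : 'cV[R]_d :=
  \col_i 'D_(delta_mx i 0) (fun w => E (u, w)) v.

Definition reg_order (R : realType) (d : nat) (E : 'cV[R]_d * 'cV[R]_d -> R)
    : nat :=
  if `[< forall u v, grad_v E u v = 0 >] then 1%N else 2%N.

Definition convKS (R : realType) (d : nat) (K : R -> 'M[R]_d)
    (S : 'cV[R]_d -> 'cV[R]_d) (u : R -> 'cV[R]_d) (x : R) : 'cV[R]_d :=
  \col_i \int[lebesgue_measure]_y ((K (x - y) *m S (u y)) i 0).

Definition solves (R : realType) (d : nat) (K : R -> 'M[R]_d)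
    (S : 'cV[R]_d -> 'cV[R]_d) (E : 'cV[R]_d * 'cV[R]_d -> R)
    (Gamma : 'cV[R]_d -> 'M[R]_d) (c : R) (u : R -> 'cV[R]_d) : Prop :=
  forall x : R,
    - derive1 (fun t : R => grad_v E (u t) (derive1 u t)) x
    + grad_u E (u x) (derive1 u x)
    + (DS S (u x))^T *m convKS K S u x
    = c *: (Gamma (u x) *m derive1 u x).

Definition phi (R : realType) (d : nat) (tau : R) (u : R -> 'cV[R]_d)
    : R -> 'cV[R]_d :=
  fun x => u (x + tau).

Definition Lcal (R : realType) (d : nat) (K : R -> 'M[R]_d)
    (S : 'cV[R]_d -> 'cV[R]_d) (E : 'cV[R]_d * 'cV[R]_d -> R)
    (u : R -> 'cV[R]_d) : R :=
  - (E (u 0, derive1 u 0) - dotv (grad_v E (u 0) (derive1 u 0)) (derive1 u 0)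
     + 2^-1 * dotv (S (u 0)) (convKS K S u 0))
  + 2^-1 *
    \int[(@lebesgue_measure R \x @lebesgue_measure R)%E]_(p in
           `]-oo, (0 : R)[ `*` `](0 : R), +oo[)
      (dotv (S (u p.1)) (K (p.1 - p.2) *m (DS S (u p.2) *m derive1 u p.2))
       - dotv (S (u p.2)) (K (p.1 - p.2) *m (DS S (u p.1) *m derive1 u p.1))).

(* Main.v *)
Require Import Defs.
From HB Require Import structures.
From mathcomp Require Import all_boot all_order all_algebra.
From mathcomp Require Import all_classical all_reals all_analysis.
From mathcomp Require Import measurable_realfun ring lra.
Import Order.TTheory GRing.Theory Num.Theory.
Import numFieldNormedType.Exports.
Local Open Scope ring_scope.
Local Open Scope classical_set_scope.

(** Put s = S(u) and s' = DS(u) u', so that s' is the derivative of s.  Moving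
the shift from the function to the domain of integration gives

  L(phi_t u) = - (J(t) + 1/2 s(t).(K * s)(t)) + 1/2 I(t),

where J = E(u, u') - grad_v E(u, u').u' is the Jacobi integral of the local
part and I(t) is the integral over the quadrant x < t < y of

  W(x, y) = s(x).K(x - y) s'(y) - s(y).K(x - y) s'(x)

([Lcal_phi]).  Each piece is then differentiated in t.

By the chain rule J' = (grad_u E - d/dx grad_v E).u', and the equation turns
this into c Gamma u'.u' - s'.(K * s) ([is_derive_jacobi_integral], and
[is_derive_jacobi_integral_vfree] when E does not depend on v, in which case u
is only C^1).  The middle term has derivative s'.(K * s) + s.(K * s')
([is_derive_vconv]).

For I, the density W is antisymmetric because K is even.  When t grows, the
quadrant gains the points (t, y) with y > t and loses the points (x, t) with
x < t; by antisymmetry losing W(x, t) is the same as gaining W(t, x), so that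
formally I'(t) is the integral of W(t, y) over the whole line, which is
s.(K * s') - s'.(K * s) because K is symmetric.  Adding up, all the nonlocal
terms cancel and - c Gamma u'.u' remains.

As K is merely integrable, W need not be continuous, and the statement on I is
proved in the integrated form I(b) - I(a) = int_a^b int_R W(x, y) dy dx
([upper_left_integral_diff]).  Up to a null set the indicator function A_t of
the quadrant satisfies A_t(x, y) - A_t(y, x) = 1_{x < t} - 1_{y < t}.  By
antisymmetry of W, 2 I(t) is thus the integral of (1_{x < t} - 1_{y < t}) W.
In the difference of the values at b and a only the strips a <= x < b and
a <= y < b are left; they contribute equally, and the first one is computed
with Fubini's theorem.  The first moment of K enters exactly once: it makes W
integrable on the quadrant ([integrable_upper_left_kernel]).  The two other
terms are integrated by the fundamental theorem of calculus. *)

Set Implicit Arguments.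
Unset Strict Implicit.
Unset Printing Implicit Defensive.

(** * Invariance of Lebesgue integrals under translation and swap *)

Section translation.
Context {R : realType}.
Local Notation mu := (@lebesgue_measure R).

Lemma lebesgue_measure_translation (c : R) (A : set R) : measurable A ->
  pushforward mu ((fun x => x + c) : _ -> measurableTypeR R) A = mu A.
Proof.
move=> mA; pose phi : measurableTypeR R -> measurableTypeR R := fun x => x + c.
have mphi : measurable_fun setT phi by exact: measurable_funD.
pose phi_mixin := isMeasurableFun.Build _ _ _ _ _ mphi.
pose shift : {mfun measurableTypeR R >-> measurableTypeR R} :=
  HB.pack phi phi_mixin.
apply/esym/(@lebesgue_measure_unique R (pushforward mu shift)) => //= _ [[a b]] _ <-.
rewrite /pushforward.
rewrite (_ : _ @^-1` _ = `](a - c), (b - c)]%classic); last first.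
  by apply/seteqP; split => x /=; rewrite !in_itv/= ltrBlDr lerBrDr.
rewrite !lebesgue_measure_itv/= !lte_fin ltrD2r.
by case: ifPn => // _; congr EFin; ring.
Qed.

Local Open Scope ereal_scope.

(** For signed functions the identity follows by splitting into positive and
negative parts. *)
Lemma integral_comp_from_ge0 d (T : measurableType d) (m : {measure set T -> \bar R})
    (phi : T -> T) :
  (forall g : T -> \bar R, measurable_fun setT g -> (forall x, 0 <= g x) ->
     \int[m]_x g (phi x) = \int[m]_x g x) ->
  forall f : T -> \bar R, measurable_fun setT f ->
     \int[m]_x f (phi x) = \int[m]_x f x.
Proof.
move=> ge0 f mf; rewrite integralE [RHS]integralE.
rewrite -[in RHS]ge0//; last exact: measurable_funepos.
rewrite -[X in _ = _ - X]ge0//; last exact: measurable_funeneg.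
by congr (_ - _); apply: eq_integral => x _; rewrite ?funeposE ?funenegE.
Qed.

Lemma integral_translation (c : R) (f : R -> \bar R) : measurable_fun setT f ->
  \int[mu]_x f (x + c)%R = \int[mu]_x f x.
Proof.
move: f; apply: (@integral_comp_from_ge0 _ _ mu (fun x => x + c)%R) => g mg g0.
have mc : measurable_fun setT
  ((fun x => (x + c)%R) : measurableTypeR R -> measurableTypeR R).
  exact: measurable_funD.
rewrite -[LHS](@ge0_integral_pushforward _ _ _ _ R _ mc mu setT g)//.
by apply: eq_measure_integral => A mA _; exact: lebesgue_measure_translation.
Qed.

Lemma integrable_translation (c : R) (f : R -> \bar R) :
  mu.-integrable setT f -> mu.-integrable setT (fun x => f (x + c)%R).
Proof.
move=> /integrableP[mf foo]; apply/integrableP; split.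
  by apply: measurableT_comp => //; exact: measurable_funD.
rewrite (integral_translation c (f := fun x => `|f x|%E))//.
exact: measurableT_comp.
Qed.

Local Notation mu2 := (mu \x mu).

(** Tonelli's theorem reduces this to two translations of the line. *)
Lemma integral_translation2 (c : R) (f : R * R -> \bar R) :
  measurable_fun setT f ->
  \int[mu2]_p f (p.1 + c, p.2 + c)%R = \int[mu2]_p f p.
Proof.
move: f; apply: (@integral_comp_from_ge0 _ _ mu2 (fun p => (p.1 + c, p.2 + c)%R)).
move=> g mg g0.
have mgc : measurable_fun setT (fun p : R * R => g (p.1 + c, p.2 + c)%R).
  apply: measurableT_comp => //; apply: measurable_fun_pair.
    by apply: measurable_funD.
  by apply: measurable_funD.
transitivity (\int[mu]_x \int[mu]_y g (x + c, y + c)%R).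
  exact: (fubini_tonelli1 (m1 := mu) (m2 := mu)
            (fun p : R * R => g (p.1 + c, p.2 + c)%R)).
transitivity (\int[mu]_x \int[mu]_y g (x, y)); last first.
  exact/esym/(fubini_tonelli1 (m1 := mu) (m2 := mu) g).
rewrite -[RHS](integral_translation c); last first.
  exact: measurable_fun_fubini_tonelli_F.
apply: eq_integral => x _.
apply: (integral_translation c (f := fun y => g (x + c, y)%R)).
exact: measurable_fun_pair2.
Qed.

Lemma integral_swap (f : R * R -> \bar R) : measurable_fun setT f ->
  \int[mu2]_p f (p.2, p.1) = \int[mu2]_p f p.
Proof.
move: f; apply: (@integral_comp_from_ge0 _ _ mu2 (fun p => (p.2, p.1))) => g mg g0.
have mgs : measurable_fun setT (fun p : R * R => g (p.2, p.1)).
  by apply: measurableT_comp => //; exact: measurable_swap.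
transitivity (\int[mu]_x \int[mu]_y g (y, x)).
  exact: (fubini_tonelli1 (m1 := mu) (m2 := mu) (fun p : R * R => g (p.2, p.1))).
by rewrite fubini_tonelli2.
Qed.

Lemma integrable_swap (f : R * R -> \bar R) : (mu \x mu).-integrable setT f ->
  (mu \x mu).-integrable setT (fun p => f (p.2, p.1)).
Proof.
move=> /integrableP[mf foo]; apply/integrableP; split.
  by apply: measurableT_comp => //; exact: measurable_swap.
rewrite (integral_swap (f := fun p => `|f p|%E))//.
exact: measurableT_comp.
Qed.

End translation.

(** * Antisymmetric densities on a moving quadrant *)

Section plane.
Context {R : realType}.
Local Notation mu := (@lebesgue_measure R).
Local Notation mu2 := (mu \x mu)%E.

Local Notation left_of t := (\1_(`]-oo, t[%classic) : R -> R).

Lemma measurable_left_of_fst t : measurable_fun setT (fun p : R * R => left_of t p.1).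
Proof. by apply: measurableT_comp => //; exact: measurable_indic. Qed.

Lemma measurable_left_of_snd t : measurable_fun setT (fun p : R * R => left_of t p.2).
Proof. by apply: measurableT_comp => //; exact: measurable_indic. Qed.

Lemma Rintegral_swap (f : R * R -> R) : measurable_fun setT f ->
  \int[mu2]_p f (p.2, p.1) = \int[mu2]_p f p.
Proof.
move=> mf; rewrite /Rintegral; congr fine.
by rewrite (integral_swap (f := fun p => (f p)%:E))//; exact/measurable_EFinP.
Qed.

(** The quadrant is taken to be x < t <= y: with this choice
[left_of t x * (1 - left_of t y) - left_of t y * (1 - left_of t x)] equals
[left_of t x - left_of t y] everywhere, the boundary lines included. *)
Definition upper_left (W : R * R -> R) (t : R) (p : R * R) : R :=
  left_of t p.1 * (1 - left_of t p.2) * W p.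

Lemma measurable_upper_left W t : measurable_fun setT W ->
  measurable_fun setT (upper_left W t).
Proof.
move=> mW; apply: measurable_funM => //; apply: measurable_funM.
  exact: measurable_left_of_fst.
by apply: measurable_funB => //; exact: measurable_left_of_snd.
Qed.

(** A translation moves the corner of the quadrant from (t, t) to the origin; the
open and the half-open quadrants differ by the null line y = 0. *)
Lemma integral_shifted_quadrant (W : R * R -> R) (t : R) :
  measurable_fun setT W ->
  \int[mu2]_(p in `]-oo, (0 : R)[ `*` `](0 : R), +oo[) W (p.1 + t, p.2 + t) =
  \int[mu2]_p upper_left W t p.
Proof.
move=> mW; rewrite /Rintegral; congr fine.
rewrite -(integral_translation2 t); last first.
  by apply/measurable_EFinP; exact: measurable_upper_left.
rewrite integral_mkcond.
have mWt : measurable_fun setT (fun p : R * R => W (p.1 + t, p.2 + t)).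
  apply: measurableT_comp => //; apply: measurable_fun_pair.
    exact: measurable_funD.
  exact: measurable_funD.
have mQ : measurable (`]-oo, (0 : R)[ `*` `](0 : R), +oo[ : set (R * R)).
  exact: measurableX.
apply: ae_eq_integral => //.
- apply: ((measurable_restrictT _ mQ).1).
  by apply: measurable_funTS; exact/measurable_EFinP.
- apply/measurable_EFinP.
  apply: (measurableT_comp (f := upper_left W t)); first exact: measurable_upper_left.
  by apply: measurable_fun_pair; exact: measurable_funD.
(* The two integrands can only differ on the boundary line y = 0. *)
exists (setT `*` [set 0%R]); split.
- exact: measurableX.
- apply: (etrans (product_measure1E mu mu measurableT (measurable_set1 0))).
  by rewrite /= lebesgue_measure_set1 mule0.
move=> [x y] /= /not_implyP[_ xy]; split => //.
apply: contrapT => y0; apply: xy.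
have {}y0 : y != 0 by apply/eqP.
rewrite patchE /upper_left/= !indicE !mem_setE !in_itv/= in_setX !mem_setE !in_itv/=.
rewrite andbT -(ltrD2r t x 0) -(ltrD2r t 0 y) !add0r.
case: ltP => _ /=; last by rewrite !mul0r.
have : t != y + t by rewrite -[X in X != _]add0r (inj_eq (addIr t)) eq_sym.
rewrite neq_lt orbC; case: ltP => //= yt; rewrite ?subrr ?subr0 ?(mulr0,mul0r,mul1r)//.
- by move=> _; rewrite ltNge (ltW yt).
- by move=> ->.
Qed.

Variables (kappa : R -> R).
Hypothesis kappa0 : forall r, 0 <= kappa r.
Hypothesis ikappa : mu.-integrable setT (EFin \o kappa).
Hypothesis imkappa : mu.-integrable setT (fun r => (`|r| * kappa r)%:E).

Let mkappa : measurable_fun setT kappa.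
Proof. by have /measurable_EFinP := measurable_int mu ikappa. Qed.

Let mdiff : measurable_fun setT (fun p : R * R => kappa (p.2 - p.1)).
Proof. by apply: measurableT_comp => //; exact: measurable_funB. Qed.

(** Tonelli and a translation in y: the double integral is the product of the
L1 norms of [a] and [kappa]. *)
Lemma integrable_strip (a : R -> R) : mu.-integrable setT (EFin \o a) ->
  mu2.-integrable setT (fun p : R * R => (a p.1 * kappa (p.2 - p.1))%:E).
Proof.
move=> ia.
have /measurable_EFinP ma := measurable_int mu ia.
apply/integrable12ltyP.
  apply/measurable_EFinP; apply: measurable_funM => //.
  by apply: measurableT_comp.
under eq_integral => x _.
  rewrite (_ : (fun y => _) = (fun y => `|a x|%:E * (kappa (y + (- x)))%:E)%E); last first.
    by apply/funext => y /=; rewrite normrM (ger0_norm (kappa0 _)) EFinM.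
  rewrite ge0_integralZl//; last first.
  - by move=> y _; rewrite lee_fin.
  - by apply/measurable_EFinP; apply: measurableT_comp => //; exact: measurable_funB.
  rewrite (integral_translation (- x) (f := EFin \o kappa)); last exact/measurable_EFinP.
  over.
have /integrableP[_ ia_fin] := ia.
rewrite ge0_integralZr//.
- apply: lte_mul_pinfty => //.
  + by apply: integral_ge0 => x _; rewrite lee_fin.
  + rewrite ge0_fin_numE//; by apply: integral_ge0 => x _; rewrite lee_fin.
  + exact: integrable_lty.
- by apply/measurable_EFinP; apply: measurableT_comp.
- by apply: integral_ge0 => x _; rewrite lee_fin.
Qed.

(** In the coordinates (x, r) with y = r + x, the sections of the quadrant in
the direction x are intervals of length max(r, 0). *)
Lemma left_of_interval (t x r : R) :
  left_of t x * (1 - left_of t (r + x)) = \1_(`[t - r, t[%classic) x.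
Proof.
rewrite !indicE !mem_setE !in_itv/= lerBlDl.
by case: (ltP x t); case: (ltP (r + x) t) => _ _; rewrite ?(subrr,mulr0,mul0r,subr0,mulr1).
Qed.

(** Substituting y = r + x and integrating first in x leaves the integral of
max(r, 0) kappa(r), which the first moment of [kappa] bounds. *)
Lemma integrable_upper_left_kernel (t : R) :
  mu2.-integrable setT (EFin \o upper_left (fun p => kappa (p.2 - p.1)) t).
Proof.
pose h (p : R * R) : \bar R := (\1_(`[t - p.2, t[%classic) p.1 * kappa p.2)%:E.
have h0 p : (0 <= h p)%E by rewrite lee_fin mulr_ge0// indicE.
have mh : measurable_fun setT h.
  rewrite /h; under eq_fun do rewrite -left_of_interval.
  apply/measurable_EFinP; apply: measurable_funM; last exact: measurableT_comp.
  apply: measurable_funM; first exact: measurable_left_of_fst.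
  apply: measurable_funB => //; apply: measurableT_comp => //.
  exact: measurable_funD.
have mG : measurable_fun setT (fun r => \int[mu]_x h (x, r))%E.
  exact: (measurable_fun_fubini_tonelli_G (m1 := mu) h).
apply/integrable12ltyP.
  by apply/measurable_EFinP; exact: measurable_upper_left.
under eq_integral => x _.
  rewrite (_ : (fun y => _) = EFin \o
      (fun y : R => upper_left (fun p => kappa (p.2 - p.1)) t (x, y))); last first.
    apply/funext => y/=; rewrite ger0_norm// /upper_left/= mulr_ge0// mulr_ge0//.
  rewrite -(integral_translation x); last first.
    apply/measurable_EFinP.
    apply: (measurable_fun_pair2 (f := upper_left (fun p : R * R => kappa (p.2 - p.1)) t)).
    exact: measurable_upper_left.
  rewrite (_ : (fun y => _) = (fun r => h (x, r))); last first.
    by apply/funext => r; rewrite /h/= -left_of_interval /upper_left/= addrK.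
  over.
rewrite (fubini_tonelli (m1 := mu) (m2 := mu) h)//.
have /integrableP[_] := imkappa.
apply: le_lt_trans; apply: ge0_le_integral => //.
- by move=> r _; exact: integral_ge0.
- by apply: measurableT_comp => //; exact: measurable_int imkappa.
move=> r _; rewrite /h/=.
under eq_integral do rewrite EFinM muleC.
rewrite ge0_integralZl//; first last.
- by rewrite lee_fin.
- by apply/measurable_EFinP; exact: measurable_indic.
rewrite integral_indic// setIT.
rewrite [X in (_ * X)%E](_ : _ = lebesgue_measure `[t - r, t[%classic)//.
rewrite lebesgue_measure_itv/= lte_fin.
rewrite ger0_norm ?mulr_ge0// EFinM muleC lee_pmul ?lee_fin//.
  by case: ifPn => //; rewrite -EFinD lee_fin ltrBlDr ltrDl opprB addrCA subrr addr0 => /ltW.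
case: ifPn => // _; rewrite -EFinD lee_fin opprB addrCA subrr addr0.
exact: ler_norm.
Qed.

Variable W : R * R -> R.
Hypothesis mW : measurable_fun setT W.
Hypothesis antiW : forall x y, W (y, x) = - W (x, y).
Hypothesis leW : forall x y, `|W (x, y)| <= kappa (y - x).

Lemma integrable_upper_left t : mu2.-integrable setT (EFin \o upper_left W t).
Proof.
apply: (le_integrable _ _ _ (integrable_upper_left_kernel t)) => //.
  by apply/measurable_EFinP; exact: measurable_upper_left.
move=> [x y] _ /=; rewrite lee_fin /upper_left/= !normrM.
apply: ler_wpM2l; first by rewrite mulr_ge0.
by rewrite (le_trans (leW _ _))// ler_norm.
Qed.

Lemma integrable_strip_dominated (a : R -> R) : mu.-integrable setT (EFin \o a) ->
  mu2.-integrable setT (fun p => (a p.1 * W p)%:E).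
Proof.
move=> ia; have /measurable_EFinP ma := measurable_int mu ia.
apply: (le_integrable _ _ _ (integrable_strip ia)) => //.
  by apply/measurable_EFinP; apply: measurable_funM => //; exact: measurableT_comp.
move=> [x y] _ /=; rewrite lee_fin !normrM.
by apply: ler_wpM2l => //; rewrite (le_trans (leW _ _))// ler_norm.
Qed.

(** Average the integral with its image under the swap of x and y, which changes
the sign of [W]. *)
Lemma upper_left_symmetrized t :
  mu2.-integrable setT (fun p => ((left_of t p.1 - left_of t p.2) * W p)%:E) /\
  2 * \int[mu2]_p upper_left W t p =
  \int[mu2]_p ((left_of t p.1 - left_of t p.2) * W p).
Proof.
have i1 := integrable_upper_left t.
have i2 := integrable_swap i1.
have E p : (left_of t p.1 - left_of t p.2) * W p =
    upper_left W t p + upper_left W t (p.2, p.1).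
  by case: p => x y; rewrite /upper_left/= (antiW x y); ring.
split.
  apply: eq_integrable (integrableD _ i1 i2) => //.
  by move=> p _ /=; rewrite E.
under [RHS]eq_Rintegral do rewrite E.
rewrite RintegralD// (Rintegral_swap (f := upper_left W t)).
  by rewrite -[X in X * _]/(1 + 1) mulrDl mul1r.
exact: measurable_upper_left.
Qed.

(** The integrated form of the following: moving the corner of the quadrant along
the diagonal changes the integral of an antisymmetric [W] at the rate of the
integral of [W] over a full vertical line. *)
Lemma upper_left_integral_diff a b : a <= b ->
  \int[mu2]_p upper_left W b p - \int[mu2]_p upper_left W a p =
  \int[mu]_(x in `[a, b]) \int[mu]_y W (x, y).
Proof.
move=> ab.
pose strip (x : R) : R := \1_(`[a, b[%classic) x.
have istrip : mu.-integrable setT (EFin \o strip) by exact: integrable_indic_itv.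
have stripE x : strip x = left_of b x - left_of a x.
  rewrite /strip !indicE !mem_setE !in_itv/=.
  case: (leP a x) => ax; case: (ltP x b) => xb; rewrite /= ?subr0 ?subrr//.
  by move: (lt_le_trans ax ab); rewrite ltNge xb.
have istripW := integrable_strip_dominated istrip.
have istripW' := integrable_swap istripW.
have mstripW : measurable_fun setT (fun p : R * R => strip p.1 * W p).
  by have /measurable_EFinP := measurable_int _ istripW.
have [ib Ib] := upper_left_symmetrized b.
have [ia Ia] := upper_left_symmetrized a.
have -> : \int[mu2]_p upper_left W b p - \int[mu2]_p upper_left W a p =
    \int[mu2]_p (strip p.1 * W p).
  apply: (@mulfI _ 2); first by rewrite pnatr_eq0.
  rewrite mulrBr Ib Ia -RintegralB//.
  (* The strips a <= x < b and a <= y < b are exchanged by the swap, with equal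
     contributions. *)
  transitivity (\int[mu2]_p (strip p.1 * W p + strip p.2 * W (p.2, p.1))).
    apply: eq_Rintegral => -[x y] _ /=.
    by rewrite (antiW x y) !stripE; ring.
  rewrite RintegralD// (Rintegral_swap (f := fun p => strip p.1 * W p))//.
  by rewrite -[X in X * _]/(1 + 1) mulrDl mul1r.
have iW x : mu.-integrable setT (fun y => (W (x, y))%:E).
  apply: (le_integrable _ _ _ (integrable_translation (- x) ikappa)) => //.
    by apply/measurable_EFinP; exact: (measurable_fun_pair2 (f := W)).
  by move=> y _ /=; rewrite lee_fin (le_trans (leW _ _))// ler_norm.
have FE x : fubini_F mu (fun p => (strip p.1 * W p)%:E) x =
    (strip x * \int[mu]_y W (x, y))%:E.
  by rewrite /fubini_F/= EFinM fineK ?integrable_fin_num// -integralZl.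
transitivity (\int[mu]_x (strip x * \int[mu]_y W (x, y))).
  rewrite /Rintegral -(integral12_prod_meas1 istripW); congr fine.
  by apply: eq_integral => x _; exact: FE.
rewrite -Rintegral_itv_bndo_bndc; last first.
  apply/integrable_mkcond => //.
  apply: eq_integrable (integrable_fubini_F istripW) => // x _.
  rewrite [LHS]FE patchE /strip indicE.
  by case: ifPn => _; rewrite ?mul1r ?mul0r.
rewrite [RHS]Rintegral_mkcond; apply: eq_Rintegral => x _.
by rewrite patchE /strip indicE; case: ifPn => _; rewrite ?mul1r ?mul0r.
Qed.

End plane.

(** * Convolution of an even kernel with a bounded function *)

Section scalar_convolution.
Context {R : realType}.
Local Notation mu := (@lebesgue_measure R).

Definition convolution (k h : R -> R) (x : R) : R := \int[mu]_y (k (x - y) * h y).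

Variable k : R -> R.
Hypothesis k_even : forall r, k r = k (- r).
Hypothesis ik : mu.-integrable setT (EFin \o k).

Let mk : measurable_fun setT k.
Proof. by have /measurable_EFinP := measurable_int mu ik. Qed.

(** In this form the variable x occurs only in [h], the factor that is regular. *)
Lemma convolutionE h x : measurable_fun setT h ->
  convolution k h x = \int[mu]_r (k r * h (r + x)).
Proof.
move=> mh; rewrite /convolution /Rintegral.
rewrite -(integral_translation x (f := fun y => (k (x - y) * h y)%:E)); last first.
  apply/measurable_EFinP; apply: measurable_funM => //.
  by apply: measurableT_comp => //; exact: measurable_funB.
by congr fine; apply: eq_integral => r _; rewrite opprD addrCA subrr addr0 -k_even.
Qed.

Lemma integrable_mul_bounded (a h : R -> R) (C : R) : mu.-integrable setT (EFin \o a) ->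
  measurable_fun setT h -> (forall x, `|h x| <= C) ->
  mu.-integrable setT (fun r => (a r * h r)%:E).
Proof.
move=> ia mh hC; have /measurable_EFinP ma := measurable_int mu ia.
apply: (le_integrable _ _ _ (integrableZl _ C ia)) => //.
  by apply/measurable_EFinP; exact: measurable_funM.
move=> r _ /=; rewrite lee_fin !normrM mulrC; apply: ler_wpM2r => //.
exact: (le_trans (hC r) (ler_norm _)).
Qed.

Lemma integrable_convolution (h : R -> R) (C x : R) :
  measurable_fun setT h -> (forall x, `|h x| <= C) ->
  mu.-integrable setT (fun y => (k (x - y) * h y)%:E).
Proof.
move=> mh hC; apply: (@integrable_mul_bounded (fun y => k (x - y)) _ C) => //.
apply: eq_integrable (integrable_translation (- x) ik) => // y _ /=.
by rewrite k_even opprB.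
Qed.

Let measurable_shift (h : R -> R) (x : R) : measurable_fun setT h ->
  measurable_fun setT (fun r : R => h (r + x)).
Proof. by move=> mh; apply: measurableT_comp => //; exact: measurable_funD. Qed.

Lemma continuous_convolution (h : R -> R) (C : R) :
  continuous h -> (forall x, `|h x| <= C) ->
  continuous (convolution k h).
Proof.
move=> ch hC; have mh := continuous_measurable_fun ch.
rewrite (_ : convolution k h = fun x => \int[mu]_r (k r * h (r + x))); last first.
  by apply/funext => x; exact: convolutionE.
move=> x.
have xI : x \in `](x - 1), (x + 1)[%classic.
  by rewrite inE/= in_itv/= ltrBlDr ltrDl ltr01.
apply: (@continuity_under_integral _ _ _ mu (fun x r => k r * h (r + x)) setT
  measurableT (x - 1) (x + 1) _ _ (fun r => C * `|k r|) _ _ x xI) => //.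
- move=> y _; apply: integrable_mul_bounded => //; exact: measurable_shift.
- apply: aeW => r _ y _; apply: (@continuousM _ _ (cst (k r))); first exact: cst_continuous.
  apply: (@continuous_comp _ _ _ (fun z => r + z) h); last exact: ch.
  by apply: continuousD => //; exact: cst_continuous.
- by apply: (integrableZl _ C (integrable_norm ik)).
- move=> y _; apply: aeW => r _; rewrite normrM mulrC.
  by apply: ler_wpM2r.
Qed.

(** The derivative falls on the regular factor [h]; the integrand is then
dominated by C' |k|. *)
Lemma is_derive_convolution (h h' : R -> R) (C C' : R) :
  (forall x : R, is_derive x 1 h (h' x)) ->
  continuous h' -> (forall x, `|h x| <= C) -> (forall x, `|h' x| <= C') ->
  forall x : R, is_derive x 1 (convolution k h) (convolution k h' x).
Proof.
move=> dh ch' hC hC' x.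
have ch : continuous h.
  by move=> y; apply/differentiable_continuous/derivable1_diffP; case: (dh y).
have mh := continuous_measurable_fun ch.
have mh' := continuous_measurable_fun ch'.
rewrite (_ : convolution k h = fun x => \int[mu]_r (k r * h (r + x))); last first.
  by apply/funext => y; exact: convolutionE.
have dkh (r y : R) : is_derive y 1 (fun z => k r * h (r + z)) (k r * h' (r + y)).
  rewrite -[_ * _]/(k r *: h' (r + y)).
  apply: (@is_deriveZ _ _ _ (fun z => h (r + z))).
  rewrite -[h' _]mulr1; apply: (@is_derive1_comp _ h (fun z => r + z)).
  rewrite -[X in is_derive _ _ _ X]add0r.
  by apply: (@is_deriveD _ _ _ (cst r) id).
have d1 : partial1of2 (fun x r => k r * h (r + x)) = fun x r => k r * h' (r + x).
  by apply/funext => y; apply/funext => r; rewrite partial1of2E; apply: derive_val.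
have xI : `](x - 1), (x + 1)[%classic x.
  by rewrite /= in_itv/= ltrBlDr ltrDl ltr01.
have C0 : 0 <= C' by rewrite (le_trans _ (hC' 0)).
have iF y : mu.-integrable setT (EFin \o (fun r => k r * h (r + y))).
  by apply: integrable_mul_bounded => //; exact: measurable_shift.
have iG : mu.-integrable setT (EFin \o (fun r => C' * `|k r|)).
  by apply: (integrableZl _ C' (integrable_norm ik)).
have G0 r : 0 <= C' * `|k r| by rewrite mulr_ge0.
have GB y r : `](x - 1), (x + 1)[%classic y -> setT r ->
    `|partial1of2 (fun x r => k r * h (r + x)) y r| <= C' * `|k r|.
  by move=> _ _; rewrite d1 normrM mulrC; apply: ler_wpM2r.
split.
  by apply: (@derivable_under_integral _ _ _ mu (fun x r => k r * h (r + x)) setT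
    measurableT x (x - 1) (x + 1) xI _ _ _ G0 iG GB) => // y r _ _; case: (dkh r y).
rewrite -derive1E (@differentiation_under_integral _ _ _ mu (fun x r => k r * h (r + x)) setT
    measurableT x (x - 1) (x + 1) xI _ _ _ G0 iG GB) //.
  by rewrite convolutionE// d1.
Qed.

End scalar_convolution.

(** * Finite sums, entries and dot products *)

Section finite_sums.
Context {R : realType}.

Lemma integrable_sum_EFin d (T : measurableType d) (m : {measure set T -> \bar R}) n
    (f : 'I_n -> T -> R) :
  (forall i, m.-integrable setT (EFin \o f i)) ->
  m.-integrable setT (EFin \o (fun x => \sum_(i < n) f i x)).
Proof.
move=> fi; rewrite (_ : _ \o _ = fun x => (\sum_(i < n) (f i x)%:E)%E).
  by apply: integrable_sum => // i _; exact: fi.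
by apply/funext => x /=; rewrite sumEFin.
Qed.

Lemma Rintegral_sum d (T : measurableType d) (m : {measure set T -> \bar R}) n
    (f : 'I_n -> T -> R) :
  (forall i, m.-integrable setT (EFin \o f i)) ->
  \int[m]_x (\sum_(i < n) f i x) = \sum_(i < n) \int[m]_x f i x.
Proof.
elim: n f => [|n IHn] f fi.
  under eq_Rintegral do rewrite big_ord0.
  by rewrite big_ord0 /Rintegral integral0.
under eq_Rintegral do rewrite big_ord_recr/=.
rewrite RintegralD//; last by apply: integrable_sum_EFin.
by rewrite IHn// big_ord_recr.
Qed.

Lemma continuous_sum (T : topologicalType) (V : normedModType R) n
    (f : 'I_n -> T -> V) :
  (forall i, continuous (f i)) -> continuous (fun x => \sum_(i < n) f i x).
Proof.
elim: n f => [|n IHn] f cf.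
  under [X in continuous X]eq_fun do rewrite big_ord0.
  exact: cst_continuous.
under [X in continuous X]eq_fun do rewrite big_ord_recr/=.
move=> x; apply: continuousD; last exact: cf.
exact: IHn.
Qed.

End finite_sums.

Section continuity.
Context {R : realType}.

Lemma continuousT_comp (T U V : topologicalType) (f : T -> U) (g : U -> V) :
  continuous f -> continuous g -> continuous (fun x => g (f x)).
Proof. by move=> cf cg x; exact: continuous_comp (cf x) (cg (f x)). Qed.

Lemma continuous_entry (T : topologicalType) m n (A : T -> 'M[R]_(m, n)) i j :
  continuous A -> continuous (fun x => A x i j).
Proof. by move=> cA; exact: continuousT_comp cA (@coord_continuous _ _ _ i j). Qed.

End continuity.

Section dot_product.
Context {R : realType} {d : nat}.
Implicit Types (v w : 'cV[R]_d) (A : 'M[R]_d).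

Lemma dotv_mulmxE (v w : 'cV[R]_d) (A : 'M[R]_d) :
  dotv v (A *m w) = \sum_(i < d) \sum_(j < d) v i 0 * (A i j * w j 0).
Proof. by apply: eq_bigr => i _; rewrite mxE mulr_sumr. Qed.

Lemma dotv_mulmx_sym (v w : 'cV[R]_d) (A : 'M[R]_d) : A = A^T ->
  dotv v (A *m w) = dotv w (A *m v).
Proof.
move=> AT; rewrite !dotv_mulmxE exchange_big/=.
apply: eq_bigr => i _; apply: eq_bigr => j _.
have -> : A i j = A j i by rewrite [in LHS]AT mxE.
by ring.
Qed.

Lemma dotvBl (v w z : 'cV[R]_d) : dotv (v - w) z = dotv v z - dotv w z.
Proof.
by rewrite /dotv -sumrB; apply: eq_bigr => i _; rewrite !mxE mulrBl.
Qed.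

Lemma dotvC (v w : 'cV[R]_d) : dotv v w = dotv w v.
Proof. by apply: eq_bigr => i _; rewrite mulrC. Qed.

Lemma dotv0l (v : 'cV[R]_d) : dotv 0 v = 0.
Proof. by rewrite /dotv big1// => i _; rewrite mxE mul0r. Qed.

Lemma dotv_trmx (A : 'M[R]_d) (v w : 'cV[R]_d) :
  dotv (A^T *m v) w = dotv v (A *m w).
Proof.
rewrite dotvC !dotv_mulmxE exchange_big/=.
by apply: eq_bigr => i _; apply: eq_bigr => j _; rewrite mxE; ring.
Qed.

Lemma dotvZl (c : R) (v w : 'cV[R]_d) : dotv (c *: v) w = c * dotv v w.
Proof. by rewrite /dotv mulr_sumr; apply: eq_bigr => i _; rewrite mxE mulrA. Qed.

Lemma normr_dotv_mulmx C (v w : 'cV[R]_d) (A : 'M[R]_d) :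
  (forall i, `|v i 0| <= C) -> (forall i, `|w i 0| <= C) ->
  `|dotv v (A *m w)| <= C ^+ 2 * \sum_(i < d) \sum_(j < d) `|A i j|.
Proof.
move=> vC wC; rewrite dotv_mulmxE (le_trans (ler_norm_sum _ _ _))// mulr_sumr.
apply: ler_sum => i _; rewrite (le_trans (ler_norm_sum _ _ _))// mulr_sumr.
apply: ler_sum => j _; rewrite !normrM mulrCA mulrC ler_wpM2r// expr2.
by apply: ler_pM.
Qed.

Lemma measurable_dotv_mulmx dT (T : measurableType dT) (v w : T -> 'cV[R]_d)
    (A : T -> 'M[R]_d) :
  (forall i, measurable_fun setT (fun x => v x i 0)) ->
  (forall i, measurable_fun setT (fun x => w x i 0)) ->
  (forall i j, measurable_fun setT (fun x => A x i j)) ->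
  measurable_fun setT (fun x => dotv (v x) (A x *m w x)).
Proof.
move=> mv mw mA; under eq_fun do rewrite dotv_mulmxE.
apply: measurable_sum => i; apply: measurable_sum => j.
by apply: measurable_funM => //; exact: measurable_funM.
Qed.

Lemma continuous_dotv (v w : R -> 'cV[R]_d) :
  (forall i, continuous (fun x => v x i 0)) ->
  (forall i, continuous (fun x => w x i 0)) ->
  continuous (fun x => dotv (v x) (w x)).
Proof.
by move=> cv cw; apply: continuous_sum => i x; apply: continuousM; [exact: cv|exact: cw].
Qed.

Lemma continuous_mulmx_entry (A : R -> 'M[R]_d) (w : R -> 'cV[R]_d) i :
  (forall i j, continuous (fun x => A x i j)) ->
  (forall i, continuous (fun x => w x i 0)) ->
  continuous (fun x => (A x *m w x) i 0).
Proof.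
move=> cA cw; under [X in continuous X]eq_fun do rewrite mxE.
by apply: continuous_sum => j x; apply: continuousM; [exact: cA|exact: cw].
Qed.

End dot_product.

(** * Matrix-valued kernels *)

Section moment.
Context {R : realType}.
Local Notation mu := (@lebesgue_measure R).

Lemma measurable_bigmaxr d (T : measurableType d) I (s : seq I) (h : I -> T -> R) :
  (forall i, measurable_fun setT (h i)) ->
  measurable_fun setT (fun x => \big[Num.max/0]_(i <- s) h i x).
Proof.
move=> mh; elim: s => [|i s IHs].
  by under eq_fun do rewrite big_nil; exact: measurable_cst.
by under eq_fun do rewrite big_cons; exact: measurable_maxr.
Qed.

(** Each entry is bounded by the matrix norm, which is measurable as a maximum of
entries. *)
Lemma integrable_moment_coef d (K : R -> 'M[R]_d) :
  (forall i j, mu.-integrable setT (fun r => (K r i j)%:E)) ->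
  (\int[mu]_r ((1 + `|r|) * `|K r|)%:E < +oo)%E ->
  forall i j, mu.-integrable setT (fun r => (`|r| * `|K r i j|)%:E).
Proof.
move=> iK moment i j.
have mK k l : measurable_fun setT (fun r => K r k l).
  by have /measurable_EFinP := measurable_int mu (iK k l).
have mnK : measurable_fun setT (fun r => `|K r|).
  rewrite (_ : (fun r => _) = fun r => \big[Num.max/0]_ij `|K r ij.1 ij.2|).
    by apply: measurable_bigmaxr => ij; exact: measurableT_comp.
  by apply/funext => r; rewrite [LHS]/Num.norm/= mx_normrE.
have mnK2 : measurable_fun setT (fun r => `|K r i j|).
  by apply: measurableT_comp => //; exact: mK.
have mnormr : measurable_fun setT (fun r : R => `|r|) by [].
apply/integrableP; split.
  by apply/measurable_EFinP; exact: measurable_funM.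
apply: le_lt_trans moment; apply: ge0_le_integral => //.
- by apply: measurableT_comp => //; apply/measurable_EFinP; exact: measurable_funM.
- apply/measurable_EFinP; apply: measurable_funM => //.
  by apply: measurable_funD.
move=> r _ /=; rewrite lee_fin ger0_norm ?mulr_ge0//.
apply: ler_pM => //; first by rewrite lerDr.
rewrite [leRHS]/Num.norm/= mx_normrE.
exact: (le_bigmax _ (fun ij => `|K r ij.1 ij.2|) (i, j)).
Qed.

End moment.

Section vector_convolution.
Context {R : realType} {d : nat}.
Local Notation mu := (@lebesgue_measure R).
Local Notation mu2 := (mu \x mu)%E.

(** For s = S o u this is convertible to the convolution [convKS K S u]; stating it
for any curve also gives a meaning to K * s'. *)
Definition vconv (K : R -> 'M[R]_d) (s : R -> 'cV[R]_d) (x : R) : 'cV[R]_d :=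
  \col_i \int[mu]_y ((K (x - y) *m s y) i 0).

Variable K : R -> 'M[R]_d.
Hypothesis K_even : forall r, K r = K (- r).
Hypothesis K_sym : forall r, K r = (K r)^T.
Hypothesis iK : forall i j, mu.-integrable setT (fun r => (K r i j)%:E).
Hypothesis imK : forall i j, mu.-integrable setT (fun r => (`|r| * `|K r i j|)%:E).

(** Entrywise, because the convolution results are applied entry by entry. *)
Definition bounded_continuous (C : R) (s : R -> 'cV[R]_d) :=
  forall i, continuous (fun x => s x i 0) /\ forall x, `|s x i 0| <= C.

Let K_even_coef i j r : K r i j = K (- r) i j.
Proof. by rewrite [in LHS]K_even. Qed.

Lemma vconvE C s (x : R) i : bounded_continuous C s ->
  vconv K s x i 0 = \sum_(j < d) convolution (fun r => K r i j) (fun y => s y j 0) x.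
Proof.
move=> bs; rewrite mxE; under eq_Rintegral do rewrite mxE.
rewrite Rintegral_sum// => j; have [cs sC] := bs j.
apply: (integrable_convolution (K_even_coef i j) (iK i j) x) sC.
exact: continuous_measurable_fun.
Qed.

Lemma continuous_vconv C (s : R -> 'cV[R]_d) i : bounded_continuous C s ->
  continuous (fun x => vconv K s x i 0).
Proof.
move=> bs; under [X in continuous X]eq_fun do rewrite (vconvE _ _ bs).
apply: continuous_sum => j; have [cs sC] := bs j.
exact: (continuous_convolution (K_even_coef i j) (iK i j) cs sC).
Qed.

Lemma is_derive_vconv C (s s' : R -> 'cV[R]_d) i (x : R) :
  (forall i (x : R), is_derive x 1 (fun t => s t i 0) (s' x i 0)) ->
  bounded_continuous C s -> bounded_continuous C s' ->
  is_derive x 1 (fun x => vconv K s x i 0) (vconv K s' x i 0).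
Proof.
move=> ds bs bs'; under eq_fun do rewrite (vconvE _ _ bs).
rewrite (vconvE _ _ bs').
rewrite -[X in is_derive _ _ X](_ : \sum_(j < d)
    convolution (fun r => K r i j) (fun y => s y j 0) = _); last first.
  by apply/funext => y; rewrite fct_sumE.
apply: is_derive_sum => j.
exact: (is_derive_convolution (K_even_coef i j) (iK i j) _ (bs' j).1 (bs j).2 (bs' j).2).
Qed.

Lemma vconv_shift C (s : R -> 'cV[R]_d) (t x : R) : bounded_continuous C s ->
  vconv K (fun y => s (y + t)) x = vconv K s (x + t).
Proof.
move=> bs; apply/colP => i.
have bst : bounded_continuous C (fun y => s (y + t)).
  move=> j; split => [y|y]; last exact: (bs j).2.
  apply: (@continuous_comp _ _ _ (fun z => z + t) (fun z => s z j 0)); last exact: (bs j).1.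
  by apply: continuousD => //; exact: cst_continuous.
rewrite (vconvE _ _ bs) (vconvE _ _ bst); apply: eq_bigr => j _.
have ms := continuous_measurable_fun (bs j).1.
have mst := continuous_measurable_fun (bst j).1.
rewrite (convolutionE (K_even_coef i j) (iK i j) _ ms).
rewrite (convolutionE (K_even_coef i j) (iK i j) _ mst).
by apply: eq_Rintegral => y _; rewrite addrA.
Qed.

(** For s = S o u and s' = (DS o u) u', this is the density of the double integral
in [Lcal]. *)
Definition coupling (s s' : R -> 'cV[R]_d) (p : R * R) : R :=
  dotv (s p.1) (K (p.1 - p.2) *m s' p.2) - dotv (s p.2) (K (p.1 - p.2) *m s' p.1).

Let kappa (C : R) (r : R) : R :=
  (2 * C ^+ 2) * \sum_(i < d) \sum_(j < d) `|K r i j|.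

Let integrable_kappa C : mu.-integrable setT (EFin \o kappa C).
Proof.
have H : mu.-integrable setT (EFin \o (fun r => \sum_(i < d) \sum_(j < d) `|K r i j|)).
  apply: integrable_sum_EFin => i; apply: integrable_sum_EFin => j.
  exact: (integrable_norm (iK i j)).
exact: (integrableZl measurableT (2 * C ^+ 2) H).
Qed.

Let integrable_moment_kappa C : mu.-integrable setT (fun r => (`|r| * kappa C r)%:E).
Proof.
have H : mu.-integrable setT (EFin \o (fun r : R =>
    \sum_(i < d) \sum_(j < d) (`|r| * `|K r i j|))).
  by apply: integrable_sum_EFin => i; apply: integrable_sum_EFin => j; exact: imK.
apply: eq_integrable (integrableZl measurableT (2 * C ^+ 2) H) => //.
move=> r _ /=; rewrite -EFinM; congr EFin; rewrite /kappa [RHS]mulrCA; congr (_ * _).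
by rewrite mulr_sumr; apply: eq_bigr => i _; rewrite mulr_sumr.
Qed.

Lemma measurable_coupling C (s s' : R -> 'cV[R]_d) :
  bounded_continuous C s -> bounded_continuous C s' ->
  measurable_fun setT (coupling s s').
Proof.
move=> bs bs'.
have mfst (t : R -> 'cV[R]_d) i : bounded_continuous C t ->
    measurable_fun setT (fun p : R * R => t p.1 i 0).
  move=> bt; apply: (measurableT_comp (f := fun x => t x i 0)) => //.
  exact: continuous_measurable_fun (bt i).1.
have msnd (t : R -> 'cV[R]_d) i : bounded_continuous C t ->
    measurable_fun setT (fun p : R * R => t p.2 i 0).
  move=> bt; apply: (measurableT_comp (f := fun x => t x i 0)) => //.
  exact: continuous_measurable_fun (bt i).1.
have mKd i j : measurable_fun setT (fun p : R * R => K (p.1 - p.2) i j).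
  apply: (measurableT_comp (f := fun r => K r i j)); last exact: measurable_funB.
  by have /measurable_EFinP := measurable_int mu (iK i j).
rewrite /coupling; apply: measurable_funB.
  by apply: measurable_dotv_mulmx => // i; [exact: mfst|exact: msnd].
by apply: measurable_dotv_mulmx => // i; [exact: msnd|exact: mfst].
Qed.

(** The coupling is antisymmetric since K is even, and is dominated by a multiple of
the sum of the |K_ij|; the symmetry of K turns its integral over a vertical line
into convolutions. *)
Lemma upper_left_coupling_diff C s s' (a b : R) :
  bounded_continuous C s -> bounded_continuous C s' -> a <= b ->
  \int[mu2]_p upper_left (coupling s s') b p -
    \int[mu2]_p upper_left (coupling s s') a p =
  \int[mu]_(x in `[a, b]) (dotv (s x) (vconv K s' x) - dotv (s' x) (vconv K s x)).
Proof.
move=> bs bs' ab.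
rewrite (@upper_left_integral_diff R (kappa C) _ (integrable_kappa C)
  (integrable_moment_kappa C) (coupling s s') _ _ _ a b ab).
- apply: eq_Rintegral => x _; rewrite /coupling/=.
  have ig (g : R -> 'cV[R]_d) i j : bounded_continuous C g ->
     mu.-integrable setT (fun y => (K (x - y) i j * g y j 0)%:E).
    move=> bg.
    apply: (integrable_convolution (K_even_coef i j) (iK i j) x _ (bg j).2).
    exact: continuous_measurable_fun (bg j).1.
  have iterm (f g : R -> 'cV[R]_d) i j : bounded_continuous C g ->
     mu.-integrable setT (fun y => (f x i 0 * (K (x - y) i j * g y j 0))%:E).
    by move=> bg; exact: (integrableZl measurableT (f x i 0) (ig g i j bg)).
  have int1 (f g : R -> 'cV[R]_d) : bounded_continuous C g ->
      mu.-integrable setT (fun y => (dotv (f x) (K (x - y) *m g y))%:E) /\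
      \int[mu]_y dotv (f x) (K (x - y) *m g y) = dotv (f x) (vconv K g x).
    move=> bg; under eq_fun do rewrite dotv_mulmxE.
    split.
      by apply: integrable_sum_EFin => i; apply: integrable_sum_EFin => j; exact: iterm.
    under eq_Rintegral do rewrite dotv_mulmxE.
    rewrite Rintegral_sum; last first.
      by move=> i; apply: integrable_sum_EFin => j; exact: iterm.
    apply: eq_bigr => i _; rewrite Rintegral_sum; last by move=> j; exact: iterm.
    rewrite (vconvE _ _ bg) mulr_sumr; apply: eq_bigr => j _.
    by rewrite RintegralZl//; exact: ig.
  have [i1 e1] := int1 s s' bs'; have [i2 e2] := int1 s' s bs.
  under eq_Rintegral do rewrite (dotv_mulmx_sym (s _) (s' x) (K_sym _)).
  by rewrite RintegralB// e1 e2.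
- move=> r; apply: mulr_ge0; first by apply: mulr_ge0 => //; exact: sqr_ge0.
  by apply: sumr_ge0 => i _; apply: sumr_ge0.
- exact: measurable_coupling bs bs'.
- by move=> x y; rewrite /coupling/= opprB -(opprB x y) -K_even.
- move=> x y; rewrite /coupling/= -[y - x]opprB /kappa.
  have -> : K (- (x - y)) = K (x - y) by rewrite -K_even.
  rewrite (le_trans (ler_normB _ _))// -mulrA [leRHS]mulrDl !mul1r.
  by apply: lerD; apply: normr_dotv_mulmx => i; (exact: (bs i).2 || exact: (bs' i).2).
Qed.

End vector_convolution.

(** * Bounds along a bounded curve *)

Section compactness.
Context {R : realType} {d : nat}.

Lemma ler_norm_coord (v : 'cV[R]_d) i : `|v i 0| <= `|v|.
Proof.
rewrite [leRHS]/Num.norm/= mx_normrE.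
exact: (le_bigmax _ (fun ij => `|v ij.1 ij.2|) (i, 0)).
Qed.

(** Transposition is a finite sum of coordinates times fixed vectors. *)
Lemma continuous_trmx_row : continuous (fun v : 'rV[R]_d => v^T).
Proof.
have -> : (fun v : 'rV[R]_d => v^T) =
    (fun v => \sum_(i < d) v 0 i *: (delta_mx i 0 : 'cV[R]_d)).
  apply/funext => v; rewrite [LHS]matrix_sum_delta; apply: eq_bigr => i _.
  by rewrite big_ord1 mxE.
apply: continuous_sum => i v.
apply: continuousZ; last exact: cst_continuous.
exact: coord_continuous.
Qed.

(** A bounded curve stays in a compact cube. *)
Lemma bounded_comp (u : R -> 'cV[R]_d) (g : 'cV[R]_d -> R) :
  bounded_fun u -> continuous g -> exists C, forall x, `|g (u x)| <= C.
Proof.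
move=> [M [_ uM1]] cg.
have {}uM1 x : `|u x| <= M + 1 by apply: uM1 => //; rewrite ltrDl.
pose B := [set v : 'rV[R]_d | forall i, (v ord0 i \in `[- (M + 1), M + 1]%R)].
(* Tychonoff's theorem is applied to row vectors, hence the transposition. *)
have cB : compact B.
  apply: (@rV_compact R d (fun=> `[- (M + 1), M + 1]%classic)) => _.
  exact: segment_compact.
have cgB : compact ((fun v : 'rV[R]_d => g v^T) @` B).
  apply: continuous_compact => //; apply: continuous_subspaceT.
  move=> v; apply: continuous_comp; last exact: cg.
  exact: continuous_trmx_row.
have [N [_ /(_ (N + 1))]] := compact_bounded cgB.
rewrite ltrDl => /(_ ltr01) gN; exists (N + 1) => x; apply: gN.
exists (u x)^T; last by rewrite trmxK.
move=> i; rewrite mxE in_itv/= -ler_norml.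
exact: le_trans (ler_norm_coord _ _) (uM1 x).
Qed.

Lemma ex_uniform_bound (I : finType) (f : I -> R -> R) :
  (forall i, exists C, forall x, `|f i x| <= C) ->
  exists C, forall i x, `|f i x| <= C.
Proof.
move=> /choice[C fC]; exists (\sum_i `|C i|) => i x.
rewrite (le_trans (fC i x))// (bigD1 i)//= (le_trans (ler_norm _))// lerDl.
exact: sumr_ge0.
Qed.

End compactness.

(** * Differentiation along curves and the energy *)

Section calculus.
Context {R : realType}.

Lemma derivable_differentiable (V : normedModType R) (u : R -> V) (x : R) :
  derivable u x 1 -> differentiable u x.
Proof. by move/derivable1_diffP. Qed.

Lemma differentiable_derivable (V : normedModType R) (u : R -> V) (x : R) :
  differentiable u x -> derivable u x 1.
Proof. by move/derivable1_diffP. Qed.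

Lemma is_derive_pair (V W : normedModType R) (f : R -> V) (g : R -> W) (x : R) :
  derivable f x 1 -> derivable g x 1 ->
  is_derive x 1 (fun t => (f t, g t)) (derive1 f x, derive1 g x).
Proof.
move=> /derivable_differentiable df /derivable_differentiable dg.
have dfg : differentiable (fun t => (f t, g t)) x by exact: differentiable_pair.
split; first exact: differentiable_derivable.
by rewrite deriveE// diff_pair//= !derive1E'.
Qed.

Lemma is_derive_comp_curve (V W : normedModType R) (u : R -> V) (F : V -> W) (x : R) v :
  is_derive x 1 u v -> differentiable F (u x) ->
  is_derive x 1 (fun t => F (u t)) ('d F (u x) v).
Proof.
move=> [/derivable_differentiable du <-] dF.
have dFu : differentiable (F \o u) x by exact: differentiable_comp.
split; first exact: differentiable_derivable.
by rewrite (deriveE _ dFu) diff_comp//= (deriveE _ du).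
Qed.

Lemma is_derive_coord (d : nat) (u : R -> 'cV[R]_d) (x : R) v i :
  is_derive x 1 u v -> is_derive x 1 (fun t => u t i 0) (v i 0).
Proof.
move=> [du <-]; split; first exact: (derivable_mxP u x 1).1.
by rewrite derive_mx// mxE.
Qed.

Lemma colE (d : nat) (v : 'cV[R]_d) : v = \sum_(i < d) v i 0 *: delta_mx i 0.
Proof.
rewrite [LHS]matrix_sum_delta; apply: eq_bigr => i _.
by rewrite big_ord1.
Qed.

Lemma mul_DS (d : nat) (S : 'cV[R]_d -> 'cV[R]_d) (a v : 'cV[R]_d) :
  differentiable S a -> DS S a *m v = 'd S a v.
Proof.
move=> dS; rewrite [in RHS](colE v) linear_sum; apply/colP => i.
rewrite mxE summxE; apply: eq_bigr => j _.
by rewrite !mxE linearZ/= mxE deriveE// mulrC.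
Qed.

Lemma derive_partial_fst (V W : normedModType R) (E : V * W -> R) a b h :
  'D_h (fun w => E (w, b)) a = 'D_(h, 0) E (a, b).
Proof.
rewrite /derive.
suff -> : (fun t : R => t^-1 *: (((fun w => E (w, b)) \o shift a) (t *: h) - E (a, b))) =
    (fun t : R => t^-1 *: ((E \o shift (a, b)) (t *: (h, 0)) - E (a, b))) by [].
apply/funext => t; congr (_ *: (E _ - _)).
by congr pair; rewrite /= scaler0 add0r.
Qed.

Lemma derive_partial_snd (V W : normedModType R) (E : V * W -> R) a b h :
  'D_h (fun w => E (a, w)) b = 'D_(0, h) E (a, b).
Proof.
rewrite /derive.
suff -> : (fun t : R => t^-1 *: (((fun w => E (a, w)) \o shift b) (t *: h) - E (a, b))) =
    (fun t : R => t^-1 *: ((E \o shift (a, b)) (t *: (0, h)) - E (a, b))) by [].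
apply/funext => t; congr (_ *: (E _ - _)).
by congr pair; rewrite /= scaler0 add0r.
Qed.

Lemma diff_grad (d : nat) (E : 'cV[R]_d * 'cV[R]_d -> R) a b h k :
  differentiable E (a, b) ->
  'd E (a, b) (h, k) = dotv (grad_u E a b) h + dotv (grad_v E a b) k.
Proof.
move=> dE.
have pair0l : (h, 0 : 'cV[R]_d) = \sum_(i < d) h i 0 *: (delta_mx i 0, 0).
  rewrite [in LHS](colE h) (big_morph (fun x => (x, 0 : 'cV[R]_d)) (id1 := 0) (op1 := +%R))//.
    by apply: eq_bigr => i _; congr pair; rewrite /= scaler0.
  by move=> x y; congr pair; rewrite /= addr0.
have pair0r : (0 : 'cV[R]_d, k) = \sum_(i < d) k i 0 *: (0, delta_mx i 0).
  rewrite [in LHS](colE k) (big_morph (fun x => (0 : 'cV[R]_d, x)) (id1 := 0) (op1 := +%R))//.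
    by apply: eq_bigr => i _; congr pair; rewrite /= scaler0.
  by move=> x y; congr pair; rewrite /= addr0.
have -> : (h, k) = (h, 0) + (0, k) by congr pair; rewrite /= ?addr0 ?add0r.
rewrite linearD pair0l pair0r !linear_sum; congr (_ + _); apply: eq_bigr => i _.
  by rewrite mxE linearZ/= derive_partial_fst deriveE// mulrC.
by rewrite mxE linearZ/= derive_partial_snd deriveE// mulrC.
Qed.

Lemma is_derive_dotv (d : nat) (v w : R -> 'cV[R]_d) (x : R) v' w' :
  is_derive x 1 v v' -> is_derive x 1 w w' ->
  is_derive x 1 (fun t => dotv (v t) (w t)) (dotv v' (w x) + dotv (v x) w').
Proof.
move=> dv dw.
rewrite -[X in is_derive _ _ X](_ : \sum_(i < d) (fun t => v t i 0 * w t i 0) = _); last first.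
  by apply/funext => y; rewrite fct_sumE.
rewrite /dotv -big_split/=; apply: is_derive_sum => i.
apply: is_derive_eq; first exact: (is_deriveM (is_derive_coord i dv) (is_derive_coord i dw)).
by rewrite addrC; congr (_ + _); exact: mulrC.
Qed.

Lemma derivable_is_derive1 (V : normedModType R) (u : R -> V) (x : R) :
  derivable u x 1 -> is_derive x 1 u (derive1 u x).
Proof. by move=> du; split => //; rewrite derive1E. Qed.

Lemma is_derive_col (d : nat) (v : R -> 'cV[R]_d) (x : R) (v' : 'cV[R]_d) :
  (forall i, is_derive x 1 (fun t => v t i 0) (v' i 0)) -> is_derive x 1 v v'.
Proof.
move=> dv; have dvx : derivable v x 1.
  by apply/derivable_mxP => i j; rewrite (ord1 j); case: (dv i).
split => //; rewrite derive_mx//; apply/colP => i; rewrite mxE.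
by case: (dv i).
Qed.

Lemma Rintegral_derivative (F f : R -> R) (a b : R) :
  (forall x : R, is_derive x 1 F (f x)) -> continuous f -> a <= b ->
  \int[@lebesgue_measure R]_(x in `[a, b]) f x = F b - F a.
Proof.
move=> dF cf; rewrite le_eqVlt => /predU1P[<-|ab].
  by rewrite set_itv1 Rintegral_set1 subrr.
have cF : continuous F.
  by move=> x; apply/differentiable_continuous/derivable1_diffP; case: (dF x).
rewrite /Rintegral (continuous_FTC2 ab (continuous_subspaceT cf) (F := F))//.
- split.
  + by move=> x _; case: (dF x).
  + exact/cvg_at_right_filter/cF.
  + exact/cvg_at_left_filter/cF.
- by move=> x _; rewrite derive1E; case: (dF x).
Qed.

Section energy.
Variables (d : nat) (E : 'cV[R]_d * 'cV[R]_d -> R).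
Hypothesis EC2 : Ck 2 E.
Variable u : R -> 'cV[R]_d.

(** The first integral of the Euler-Lagrange equation
- (grad_v E(u, u'))' + grad_u E(u, u') = 0. *)
Definition jacobi_integral (t : R) : R :=
  E (u t, derive1 u t) - dotv (grad_v E (u t) (derive1 u t)) (derive1 u t).

(** The terms grad_v E.u'' coming from E and from grad_v E.u' cancel. *)
Lemma is_derive_jacobi_integral (x : R) : derivable u x 1 -> derivable (derive1 u) x 1 ->
  is_derive x 1 jacobi_integral
    (dotv (grad_u E (u x) (derive1 u x)
           - derive1 (fun t => grad_v E (u t) (derive1 u t)) x) (derive1 u x)).
Proof.
move=> du du'; have [dE dE'] := EC2.
have dz := is_derive_pair du du'.
have dEz : is_derive x 1 (fun t => E (u t, derive1 u t))
    (dotv (grad_u E (u x) (derive1 u x)) (derive1 u x) +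
     dotv (grad_v E (u x) (derive1 u x)) (derive1 (derive1 u) x)).
  by rewrite -diff_grad//; exact: (is_derive_comp_curve dz).
have dG : derivable (fun t => grad_v E (u t) (derive1 u t)) x 1.
  apply/derivable_mxP => i j; rewrite (ord1 j).
  under eq_fun do rewrite mxE derive_partial_snd.
  have [dF _] := dE' (0, delta_mx i 0).
  by have [] := is_derive_comp_curve dz (dF _).
have dDot := is_derive_dotv (derivable_is_derive1 dG) (derivable_is_derive1 du').
have dN : is_derive x 1 jacobi_integral _ := is_deriveB dEz dDot.
apply: (is_derive_eq dN).
by rewrite dotvBl opprD addrACA subrr addr0.
Qed.

(** If grad_v E vanishes identically then E(u, u') = E(u, 0), so that the second
derivative of u, which need not exist, never appears. *)
Lemma is_derive_jacobi_integral_vfree (x : R) : (forall a b, grad_v E a b = 0) ->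
  derivable u x 1 ->
  is_derive x 1 jacobi_integral
    (dotv (grad_u E (u x) (derive1 u x)
           - derive1 (fun t => grad_v E (u t) (derive1 u t)) x) (derive1 u x)).
Proof.
move=> gv0 du; have [dE _] := EC2.
have Eb a b : E (a, b) = E (a, 0).
  pose vline (t : R) := E (a, t *: b).
  have dvline (t : R) : is_derive t 1 vline 0.
    have dtb : derivable (fun r : R => r *: b) t 1.
      by apply: differentiable_derivable; exact: differentiableZl.
    have dz := is_derive_pair (derivable_cst a t 1) dtb.
    apply: is_derive_eq; first exact: (is_derive_comp_curve dz).
    by rewrite diff_grad// gv0 dotv0l addr0 derive1_cst dotvC dotv0l.
  by have := is_derive_0_is_cst 1 0 dvline; rewrite /vline scale1r scale0r.
have -> : jacobi_integral = (fun a => E (a, 0)) \o u.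
  by apply/funext => t; rewrite /jacobi_integral gv0 dotv0l subr0 Eb.
have -> : (fun t => grad_v E (u t) (derive1 u t)) = cst 0.
  by apply/funext => t; rewrite gv0.
rewrite derive1_cst subr0.
have -> : grad_u E (u x) (derive1 u x) = grad_u E (u x) 0.
  apply/colP => i; rewrite !mxE; congr ('D_ _ _ _); apply/funext => w; exact: Eb.
have dz := is_derive_pair du (derivable_cst (0 : 'cV[R]_d) x 1).
apply: is_derive_eq; first exact: (is_derive_comp_curve dz).
by rewrite diff_grad// gv0 dotv0l addr0.
Qed.

End energy.
End calculus.

(** * The Lyapunov functional along a solution *)

Unset Implicit Arguments.

Section lyapunov.
Context {R : realType} {d : nat}.
Local Notation mu := (@lebesgue_measure R).
Local Notation mu2 := (mu \x mu)%E.
Variables (K : R -> 'M[R]_d) (S : 'cV[R]_d -> 'cV[R]_d).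
Variables (E : 'cV[R]_d * 'cV[R]_d -> R) (Gamma : 'cV[R]_d -> 'M[R]_d) (c : R).
Hypothesis K_even : forall r, K r = K (- r).
Hypothesis K_sym : forall r, K r = (K r)^T.
Hypothesis iK : forall i j, mu.-integrable setT (fun r => (K r i j)%:E).
Hypothesis imK : forall i j, mu.-integrable setT (fun r => (`|r| * `|K r i j|)%:E).
Hypothesis SC2 : Ck 2 S.
Hypothesis EC2 : Ck 2 E.
Hypothesis Gamma_cont : continuous Gamma.
Variable u : R -> 'cV[R]_d.
Hypothesis u_smooth : Ckb (reg_order E) u.
Hypothesis u_sol : solves K S E Gamma c u.

Let s (x : R) := S (u x).
Let s' (x : R) := DS S (u x) *m derive1 u x.

Let reg_gt0 : (0 < reg_order E)%N.
Proof. by rewrite /reg_order; case: ifP. Qed.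

Let du (x : R) : derivable u x 1.
Proof. exact: u_smooth.1 0 x reg_gt0. Qed.

Let cu : continuous u. Proof. by have [] := u_smooth.2 0 (leq0n _). Qed.

Let bu : bounded_fun u. Proof. by have [] := u_smooth.2 0 (leq0n _). Qed.

Let cu' i : continuous (fun x => derive1 u x i 0).
Proof. by apply: continuous_entry; have [] := u_smooth.2 1 reg_gt0. Qed.

Let bu' i : exists C, forall x, `|derive1 u x i 0| <= C.
Proof.
have [_ bu'] := u_smooth.2 1 reg_gt0.
exact: bounded_comp bu' (@coord_continuous _ _ _ _ _).
Qed.

Let dS a : differentiable S a. Proof. exact: SC2.1. Qed.

Let cS i : continuous (fun a => S a i 0).
Proof. by apply: continuous_entry => a; exact: differentiable_continuous. Qed.

Let cDS i j : continuous (fun a => DS S a i j).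
Proof.
under [X in continuous X]eq_fun do rewrite mxE.
apply: continuous_entry => a; apply: differentiable_continuous.
exact: (SC2.2 _).1.
Qed.

Let ds (x : R) : is_derive x 1 s (s' x).
Proof.
rewrite /s' (mul_DS _ (dS (u x))).
exact: is_derive_comp_curve (derivable_is_derive1 (du x)) (dS (u x)).
Qed.

Let cs i : continuous (fun x => s x i 0).
Proof. exact: continuousT_comp cu (cS i). Qed.

Let cs' i : continuous (fun x => s' x i 0).
Proof.
apply: continuous_mulmx_entry => // k j.
exact: continuousT_comp cu (cDS k j).
Qed.

Let bs' i : exists C, forall x, `|s' x i 0| <= C.
Proof.
have [C1 DSC1] : exists C, forall j x, `|DS S (u x) i j| <= C.
  apply: ex_uniform_bound => j.
  exact: (bounded_comp (g := fun a => DS S a i j)) bu (cDS _ _).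
have [C2 u'C2] := ex_uniform_bound bu'.
exists (\sum_(j < d) C1 * C2) => x; rewrite mxE.
rewrite (le_trans (ler_norm_sum _ _ _))//; apply: ler_sum => j _.
by rewrite normrM ler_pM.
Qed.

Let exists_bound : exists C, bounded_continuous C s /\ bounded_continuous C s'.
Proof.
pose f (i : 'I_d + 'I_d) x :=
  match i with inl j => s x j 0 | inr j => s' x j 0 end.
have [C bC] : exists C, forall i x, `|f i x| <= C.
  apply: ex_uniform_bound => -[i|i]; last exact: bs'.
  exact: bounded_comp bu (cS i).
exists C; split => i; split.
- exact: cs.
- by move=> x; exact: bC (inl i) x.
- exact: cs'.
- by move=> x; exact: bC (inr i) x.
Qed.

Lemma vconv_convKS x : convKS K S u x = vconv K s x.
Proof. by []. Qed.

Lemma derive1_phi (v : R -> 'cV[R]_d) (t x : R) :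
  derive1 (phi t v) x = derive1 v (x + t).
Proof.
rewrite /derive1; set f := (fun _ => _); set g := (fun _ => _).
suff -> : f = g by [].
by apply/funext => h; rewrite /f/g /phi addrA.
Qed.

(** The density depends on x - y only through K, so the shift of u becomes a
translation of the quadrant. *)
Lemma Lcal_phi t : Lcal K S E (phi t u) =
  - (jacobi_integral E u t + 2^-1 * dotv (s t) (vconv K s t)) +
  2^-1 * \int[mu2]_p upper_left (coupling K s s') t p.
Proof.
have [C [bcs bcs']] := exists_bound.
rewrite /Lcal !derive1_phi /jacobi_integral.
rewrite (_ : convKS K S (phi t u) 0 = vconv K (fun y => s (y + t)) 0)//.
rewrite (vconv_shift K_even iK t 0 bcs) /phi !add0r.
congr (_ + _ * _); rewrite -integral_shifted_quadrant; last first.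
  exact: (measurable_coupling iK bcs bcs').
apply: eq_Rintegral => p _; rewrite !derive1_phi /coupling/= /s/s'.
have e : p.1 + t - (p.2 + t) = p.1 - p.2 by rewrite opprD addrACA subrr addr0.
by rewrite e.
Qed.

Let density (x : R) : R := c * dotv (Gamma (u x) *m derive1 u x) (derive1 u x).
Let exchange (x : R) : R := dotv (s x) (vconv K s' x) - dotv (s' x) (vconv K s x).

(** The derivative of the local part is [density + exchange / 2], and half of the
increment of the quadrant integral is the integral of [exchange / 2]: the
exchange terms cancel. *)
Lemma Lcal_diff (a b : R) : a <= b ->
  Lcal K S E (phi b u) - Lcal K S E (phi a u) =
  - c * \int[mu]_(x in `[a, b]) dotv (Gamma (u x) *m derive1 u x) (derive1 u x).
Proof.
move=> ab; have [C [bcs bcs']] := exists_bound.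
pose T t := jacobi_integral E u t + 2^-1 * dotv (s t) (vconv K s t).
have dN (x : R) : is_derive x 1 (jacobi_integral E u)
    (dotv (grad_u E (u x) (derive1 u x)
           - derive1 (fun t => grad_v E (u t) (derive1 u t)) x) (derive1 u x)).
  have := u_smooth.1; rewrite /reg_order; case: asboolP => gv du_.
    exact: is_derive_jacobi_integral_vfree.
  by apply: is_derive_jacobi_integral => //; exact: (du_ 1 x).
have dA (x : R) : is_derive x 1 (fun t => dotv (s t) (vconv K s t))
    (dotv (s' x) (vconv K s x) + dotv (s x) (vconv K s' x)).
  apply: is_derive_dotv => //; apply: is_derive_col => i.
  by apply: (is_derive_vconv K_even iK i x _ bcs bcs') => j y; exact: is_derive_coord.
have dT (x : R) : is_derive x 1 T (density x + 2^-1 * exchange x).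
  have dTx : is_derive x 1 T _ := is_deriveD (dN x) (is_deriveZ (2^-1) (dA x)).
  apply: (is_derive_eq dTx).
  have -> : grad_u E (u x) (derive1 u x) -
       derive1 (fun t => grad_v E (u t) (derive1 u t)) x =
      c *: (Gamma (u x) *m derive1 u x) - (DS S (u x))^T *m vconv K s x.
    (* This is the equation satisfied by u. *)
    by rewrite -(u_sol x) vconv_convKS addrK addrC.
  rewrite dotvBl dotvZl dotv_trmx -/(s' x) /density /exchange (dotvC (vconv _ _ _)).
  rewrite -[_ *: _]/(_ * _); lra.
have ccoord (v : R -> 'cV[R]_d) i : bounded_continuous C v ->
    continuous (fun x => vconv K v x i 0) by exact: continuous_vconv.
have cdens : continuous (fun x => dotv (Gamma (u x) *m derive1 u x) (derive1 u x)).
  apply: continuous_dotv => // i; apply: continuous_mulmx_entry => // k j.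
  exact: continuous_entry (continuousT_comp cu Gamma_cont).
have cex : continuous exchange.
  have c1 : continuous (fun x => dotv (s x) (vconv K s' x)).
    by apply: continuous_dotv => // i; exact: ccoord.
  have c2 : continuous (fun x => dotv (s' x) (vconv K s x)).
    by apply: continuous_dotv => // i; exact: ccoord.
  by move=> x; exact: cvgB (c1 x) (c2 x).
have cdensity : continuous density.
  by move=> x; exact: cvgM (cvg_cst c) (cdens x).
have cexchange : continuous (fun x => 2^-1 * exchange x).
  by move=> x; exact: cvgM (cvg_cst _) (cex x).
have cf : continuous (fun x => density x + 2^-1 * exchange x).
  by move=> x; exact: cvgD (cdensity x) (cexchange x).
have int_seg (f : R -> R) : continuous f -> mu.-integrable `[a, b] (EFin \o f).
  move=> cff; apply: continuous_compact_integrable; first exact: segment_compact.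
  exact: continuous_subspaceT.
have FTC := Rintegral_derivative dT cf ab.
have I := upper_left_coupling_diff K_even K_sym iK imK bcs bcs' ab.
rewrite RintegralD//= in FTC; [|exact: int_seg..].
rewrite RintegralZl//= in FTC; last exact: int_seg.
rewrite RintegralZl//= in FTC; last exact: int_seg.
rewrite !Lcal_phi -/(T a) -/(T b).
move: FTC I; rewrite /exchange; lra.
Qed.

End lyapunov.

Theorem lemma4p1 (R : realType) (d : nat)
  (K : R -> 'M[R]_d) (S : 'cV[R]_d -> 'cV[R]_d)
  (E : 'cV[R]_d * 'cV[R]_d -> R) (Gamma : 'cV[R]_d -> 'M[R]_d) (c : R)
  (Keven : forall r, K r = K (- r))
  (Ksym : forall r, K r = (K r)^T)
  (KL1 : forall i j,
     (@lebesgue_measure R).-integrable setT (fun r => (K r i j)%:E))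
  (Kmoment :
     (\int[@lebesgue_measure R]_r ((1 + `|r|) * `|K r|)%:E < +oo)%E)
  (SC2 : Ck 2 S) (EC2 : Ck 2 E)
  (Gcont : continuous Gamma) (Gbnd : bounded_fun Gamma)
  (Gpos : forall v, posdefmx (Gamma v))
  (c0 : c != 0) :
  ((forall u, Ckb (reg_order E) u -> solves K S E Gamma c u ->
      nonincreasing_fun (fun tau : R => Lcal K S E (phi tau u))) \/
   (forall u, Ckb (reg_order E) u -> solves K S E Gamma c u ->
      nondecreasing_fun (fun tau : R => Lcal K S E (phi tau u)))) /\
  (forall u, Ckb (reg_order E) u -> solves K S E Gamma c u ->
     forall a b : R, a <= b ->
     Lcal K S E (phi b u) - Lcal K S E (phi a u) =
     - c * \int[@lebesgue_measure R]_(x in `[a, b])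
             dotv (Gamma (u x) *m derive1 u x) (derive1 u x)).
Proof.
have imK := integrable_moment_coef KL1 Kmoment.
have dL u (Hu : Ckb (reg_order E) u) (Hs : solves K S E Gamma c u) a b (ab : a <= b) :=
  Lcal_diff K S E Gamma c Keven Ksym KL1 imK SC2 EC2 Gcont u Hu Hs a b ab.
have dissipation_ge0 u a b : 0 <= \int[@lebesgue_measure R]_(x in `[a, b])
    dotv (Gamma (u x) *m derive1 u x) (derive1 u x).
  apply: Rintegral_ge0 => x _.
  have [->|u'0] := eqVneq (derive1 u x) 0; first by rewrite dotvC dotv0l.
  exact/ltW/Gpos.
split; last exact: dL.
have [c_gt0|c_lt0|c_eq0] := ltgtP 0 c; last by rewrite -c_eq0 eqxx in c0.
- left => u Hu Hs a b ab; rewrite -subr_le0 dL// mulNr oppr_le0.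
  by rewrite mulr_ge0// ltW.
- right => u Hu Hs a b ab; rewrite -subr_ge0 dL// mulr_ge0//.
  by rewrite oppr_ge0 ltW.
Qed.
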